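(* Let $p$ be a prime number such that $p \equiv 1 \pmod 4$. Then: (i) if $p \equiv 1 \pmod 8$, then $\kappa(p) \equiv \kappa(4p) + 2 \pmod 4$; (ii) if $p \equiv 5 \pmod 8$, then $\kappa(p) \equiv \kappa(4p) \pmod 4$.
   Context: A real quadratic number is a real irrational root $w$ of a quadratic polynomial with integer coefficients; $w'$ denotes its algebraic conjugate over $\mathbb{Q}$. The discriminant $\mathrm{disc}(w)$ of $w$ is $b^2-4ac$, where $aw^2+bw+c=0$ with $a,b,c\in\mathbb{Z}$, $a>0$, $\gcd(a,b,c)=1$. A real quadratic number $w$ is reduced if $w>1$ and $-1<w'<0$. For a positive non-square integer $D$, $\kappa(D)$ denotes the (finite) number of reduced real quadratic numbers $w$ with $\mathrm{disc}(w)=D$. *)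

(* Defs.v *)
From mathcomp Require Import all_boot all_order all_algebra.
From mathcomp Require Import finmap.
From mathcomp Require Import boolp classical_sets functions cardinality reals.
From mathcomp Require Import ring lra zify.

Set Implicit Arguments.
Unset Strict Implicit.
Unset Printing Implicit Defensive.

Import Order.TTheory GRing.Theory Num.Theory.
Local Open Scope ring_scope.
Local Open Scope classical_set_scope.

Section RealQuadratic.
Variable R : realType.
Implicit Types (w v : R) (a b c d : int).

Definition quad_eval a b c w : R := a%:~R * w ^+ 2 + b%:~R * w + c%:~R.

Definition real_quadratic w : Prop :=
  irrational w /\ exists a b c, a != 0 /\ quad_eval a b c w = 0.

(* [v] is the conjugate of [w] over the rationals: the root other than [w] of
   the minimal polynomial of [w].  It is unique when [w] is quadratic. *)
Definition is_conjugate w v : Prop :=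
  v != w /\
  exists m : {poly rat}, [/\ m \is monic, irreducible_poly m,
    root (map_poly ratr m) w & root (map_poly ratr m) v].

(* The triple (a, b, c), hence d, is unique when [w] is quadratic. *)
Definition is_disc w d : Prop :=
  exists a b c, [/\ 0 < a, gcdz (gcdz a b) c = 1, quad_eval a b c w = 0
                  & d = b ^+ 2 - 4 * a * c].

Definition reduced w : Prop :=
  [/\ real_quadratic w, 1 < w & exists v, is_conjugate w v /\ -1 < v < 0].

Definition reduced_of_disc (D : nat) : set R :=
  [set w | reduced w /\ is_disc w D%:Z].

(* [fset_set] is the empty set on infinite sets; see [finite_reduced_of_disc]. *)
Definition kappa (D : nat) : nat := #|` fset_set (reduced_of_disc D)|.

Lemma conjugate_root a b c w v : a != 0 ->
  is_conjugate w v -> quad_eval a b c w = 0 -> quad_eval a b c v = 0.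
Proof.
move=> a0 [_ [m [_ irrm mw mv]]] qw.
pose q : {poly rat} := a%:~R *: 'X^2 + b%:~R *: 'X + c%:~R%:P.
have qE x : (map_poly ratr q).[x] = quad_eval a b c x.
  by rewrite /q /quad_eval !rmorphD /= !map_polyZ /= map_polyXn map_polyX
    map_polyC /= !hornerE /= !ratr_int.
have qw0 : root (map_poly ratr q) w by rewrite rootE qE qw.
have : ~~ coprimep m q.
  apply/negP => mq.
  have : coprimep (map_poly (ratr : rat -> R) m) (map_poly ratr q).
    by rewrite coprimep_map.
  by move/coprimep_root => /(_ _ mw); rewrite -rootE qw0.
rewrite irreducible_poly_coprime// negbK => mq.
have : map_poly (ratr : rat -> R) m %| map_poly ratr q by rewrite dvdp_map.
by move/dvdp_trans => H; rewrite -qE; apply/rootP; apply: (root_dvdp _ mv); rewrite dvdp_map.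
Qed.

Lemma finite_reduced_of_disc (D : nat) : finite_set (reduced_of_disc D).
Proof.
pose f (ij : nat * nat) : R := (ij.2%:R + Num.sqrt D%:R) / (2 * ij.1%:R).
apply: (@sub_finite_set _ _ (f @` (`I_D.+1 `*` `I_D.+1))); last first.
  by apply: finite_image; apply: finite_setX; exact: finite_II.
move=> w [[_ w1 [v [wv /andP[v1 v0]]]] [a [b [c [a0 _ qw dD]]]]].
have qv := conjugate_root (lt0r_neq0 a0) wv qw.
have a0R : 0 < a%:~R :> R by rewrite ltr0z.
have w_v : 0 < w - v by lra.
have bE : b%:~R = - (a%:~R * (w + v)) :> R.
  apply: (mulIf (lt0r_neq0 w_v)).
  by move: qw qv; rewrite /quad_eval => qw qv; lra.
have cE : c%:~R = a%:~R * (w * v) :> R.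
  by move: qw; rewrite /quad_eval bE => qw; lra.
have b0 : b < 0.
  by rewrite -(ltrz0 R) bE oppr_lt0 mulr_gt0//; lra.
have c0 : c < 0 by rewrite -(ltrz0 R) cE pmulr_rlt0// pmulr_rlt0//; lra.
have aD : a <= D%:Z by nia.
have bD : - b <= D%:Z by nia.
exists (`|a|%N, `|b|%N); first by split => /=; lia.
rewrite /f /=.
have aN : `|a|%N%:R = a%:~R :> R by rewrite -[a in RHS]gtz0_abs.
have bN : `|b|%N%:R = - b%:~R :> R.
  by rewrite -[b in RHS]opprK -(ltz0_abs b0) mulrNz opprK.
have -> : D%:R = (a%:~R * (w - v)) ^+ 2 :> R.
  have -> : D%:R = (D%:Z)%:~R :> R by [].
  rewrite dD rmorphB expr2 !rmorphM /= bE cE.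
  by ring.
rewrite sqrtr_sqr ger0_norm; last by rewrite mulr_ge0// ltW.
rewrite aN bN bE.
by field; rewrite lt0r_neq0.
Qed.

End RealQuadratic.

(* Main.v *)
(* A reduced number (b + sqrt D) / (2 a) corresponds to a primitive triple
   (a, b, c) with a, c > 0, |a - c| < b and b ^ 2 + 4 a c = D; for D = p every
   triple is primitive, for D = 4 p exactly those with a, c not both even.
   Triples for p with a = c mod 2 biject with the triples for 4 p with a, c odd,
   and exchanging a and c pairs up the remaining ones; so
   kappa(p) - kappa(4 p) = 2 (x - y), where x and y count the triples for p and
   4 p with a odd and c even.  The involution w |-> floor w - w' preserves a and
   the parities of a and c.  Up to the exchange of a and c it has no fixed point
   on the triples counted by y, so y is even; it has exactly one on those counted
   by x when p = 1 mod 8, so x is then odd, while x = 0 when p = 5 mod 8. *)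
Require Import Defs.
From mathcomp Require Import all_boot all_order all_algebra reals.
From mathcomp Require Import finmap boolp classical_sets functions cardinality.
From mathcomp Require Import ring lra zify.

Section CaliberParity.
Set Implicit Arguments.
Unset Strict Implicit.
Unset Printing Implicit Defensive.
Import Order.TTheory GRing.Theory Num.Theory.
Local Open Scope ring_scope.
Local Open Scope classical_set_scope.

(** * Counting in finite sets: injections, inverse bijections, disjoint unions, involutions *)

Definition ncard (T : choiceType) (A : set T) : nat := #|` fset_set A|.

Lemma ncard_inj (T U : choiceType) (f : T -> U) (A : set T) :
  finite_set A -> {in A &, injective f} -> ncard (f @` A) = ncard A.
Proof.
move=> finA injf; rewrite /ncard fset_set_image// card_in_imfset//.
by move=> x y; rewrite !in_fset_set// => xA yA; apply: injf.
Qed.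

Lemma ncard_cancel (T U : choiceType) (f : T -> U) (g : U -> T)
    (A : set T) (B : set U) :
  finite_set A -> (forall x, A x -> B (f x) /\ g (f x) = x) ->
  (forall y, B y -> A (g y) /\ f (g y) = y) -> ncard A = ncard B.
Proof.
move=> finA fA gB; have -> : B = f @` A.
  apply/seteqP; split=> [y By|_ [x Ax <-]]; last by case: (fA x Ax).
  by exists (g y); case: (gB y By).
rewrite ncard_inj// => x y /set_mem Ax /set_mem Ay fxy.
by rewrite -(fA x Ax).2 fxy (fA y Ay).2.
Qed.

Lemma ncard_split (T : choiceType) (A B C : set T) :
  finite_set A -> (forall x, A x <-> B x \/ C x) ->
  (forall x, B x -> ~ C x) -> ncard A = (ncard B + ncard C)%N.
Proof.
move=> finA ABC BC; have AE : A = B `|` C by apply/seteqP; split=> x /ABC.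
have finB : finite_set B by apply: sub_finite_set finA; rewrite AE; left.
have finC : finite_set C by apply: sub_finite_set finA; rewrite AE; right.
rewrite /ncard AE fset_setU// cardfsU -fset_setI//.
suff -> : B `&` C = set0 by rewrite fset_set0 cardfs0 subn0.
by apply/seteqP; split=> x // [/BC].
Qed.

(* The points moved by the involution split into those below and those above
   their image in an enumeration of [T], and [f] exchanges these two halves. *)
Lemma odd_ncard_involution (T : countType) (f : T -> T) (A F : set T) :
  finite_set A -> (forall x, A x -> A (f x) /\ f (f x) = x) ->
  (forall x, F x <-> A x /\ f x = x) -> odd (ncard A) = odd (ncard F).
Proof.
move=> finA fA FE.
pose L := [set x | A x /\ (choice.pickle x < choice.pickle (f x))%N].
pose G := [set x | A x /\ (choice.pickle (f x) < choice.pickle x)%N].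
pose M := [set x | A x /\ f x <> x].
have finM : finite_set M by apply: sub_finite_set finA => x [].
have finL : finite_set L by apply: sub_finite_set finA => x [].
have -> : ncard A = (ncard F + ncard M)%N.
  apply: ncard_split => // [x|x /FE[_ fx] [_ //]].
  split=> [Ax|[/FE[]|[]]//].
  by case: (pselect (f x = x)) => fx; [left; apply/FE | right].
have -> : ncard M = (ncard L + ncard G)%N.
  apply: ncard_split => // [x|x [_ xy] [_]]; last by rewrite ltnNge ltnW.
  split=> [[Ax fx]|[[Ax lx]|[Ax gx]]].
  - case: (ltngtP (choice.pickle x) (choice.pickle (f x))); [by left|by right|].
    by move=> /(pcan_inj choice.pickleK) xf; case: fx.
  - by split=> // fx; rewrite fx ltnn in lx.
  - by split=> // fx; rewrite fx ltnn in gx.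
have -> : ncard G = ncard L.
  apply/esym/(ncard_cancel (f := f) (g := f)) => // x [Ax]; have [Afx ffx] := fA x Ax;
    by rewrite /L /G /= ffx.
by rewrite addnn oddD odd_double addbF.
Qed.

(** * Reduced forms and the flip involution *)

Definition form := (int * int * int)%type.

Implicit Types (a b c k s D : int).

(** The triple stands for [a x ^ 2 - b x - c], with roots [w] and [w']. Here [c > 0] says
    [w w' < 0], while the two inequalities on [b] say [(w - 1) (1 - w') > 0] and
    [(w + 1) (1 + w') > 0]. *)
Definition reduced_form D : set form := [set f | let: (a, b, c) := f in
  [/\ 0 < a, 0 < c, a - c < b, c - a < b & b ^+ 2 + 4 * a * c = D]].

Definition primitive_form : set form :=
  [set f | let: (a, b, c) := f in gcdz (gcdz a b) c = 1].

Lemma finite_reduced_form D : finite_set (reduced_form D).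
Proof.
pose f (u : nat * nat * nat) : form := (u.1.1%:Z, u.1.2%:Z, u.2%:Z).
apply: (@sub_finite_set _ _
  (f @` (`I_`|D|.+1 `*` `I_`|D|.+1 `*` `I_`|D|.+1))); last first.
  by apply: finite_image; do 2?apply: finite_setX; exact: finite_II.
move=> [[a b] c] [a0 c0 acb cab DE].
exists (`|a|%N, `|b|%N, `|c|%N); last by rewrite /f /=; congr (_, _, _); lia.
have b0 : 0 < b by lia.
have ? : 1 <= b * b by nia.
have ? : a <= a * c by nia.
have ? : c <= a * c by nia.
have ? : b <= b * b by nia.
rewrite expr2 in DE; by split; [split|] => /=; lia.
Qed.

(* The coefficient map of [w |-> floor w - w'] on reduced numbers
   [w = (b + sqrt D) / (2 * a)]; there [floor w = (b + s) %/ (2 * a)]. *)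
Definition floor_flip s (f : form) : form :=
  let: (a, b, c) := f in
  let k := ((b + s) %/ (2 * a))%Z in
  (a, 2 * a * k - b, c + k * b - k ^+ 2 * a).

(** The integer part of [sqrt D]. The strict lower bound rules out squares, so that comparing
    [x ^+ 2] with [D] in either direction becomes a linear condition on [x]. *)
Definition int_sqrt_of s D := 0 <= s /\ s ^+ 2 < D < (s + 1) ^+ 2.

Lemma sqr_lt_int_sqrt s D x : int_sqrt_of s D ->
  (x ^+ 2 < D) = (- s <= x <= s).
Proof. by rewrite /int_sqrt_of; move=> [s0 /andP[sD Ds]]; apply/idP/idP; nia. Qed.

Lemma int_sqrt_lt_sqr s D x : int_sqrt_of s D ->
  (D < x ^+ 2) = ~~ (- s <= x <= s).
Proof. by rewrite /int_sqrt_of; move=> [s0 /andP[sD Ds]]; apply/idP/idP; nia. Qed.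

(** These are the integer versions of [w' < 0], [w > 1] and [w' > -1]: the differences between [D]
    and [(2 * a - b) ^+ 2], [(2 * a + b) ^+ 2] are multiples of [4 * a] by factors whose sign is
    known. *)
Lemma reduced_form_bounds s D a b c : int_sqrt_of s D ->
  reduced_form D (a, b, c) -> [/\ 0 < b, b <= s, 2 * a <= b + s & s - b < 2 * a].
Proof.
move=> sD [a0 c0 acb cab DE].
have b0 : 0 < b by lia.
have ac0 : 0 < a * c by rewrite mulr_gt0.
split=> //.
- have : b ^+ 2 < D by lia.
  by rewrite (sqr_lt_int_sqrt _ sD) => /andP[].
- have : (2 * a - b) ^+ 2 < D by rewrite -DE; nia.
  by rewrite (sqr_lt_int_sqrt _ sD); lia.
- have : ~~ ((2 * a + b) ^+ 2 < D) by rewrite -leNgt -DE; nia.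
  by rewrite (sqr_lt_int_sqrt _ sD); lia.
Qed.

Lemma floor_bounds s a b : 0 < a ->
  2 * a * ((b + s) %/ (2 * a))%Z <= b + s < 2 * a * ((b + s) %/ (2 * a))%Z + 2 * a.
Proof.
move=> a0; have a20 : 0 < 2 * a by lia.
rewrite {2 3}(divz_eq (b + s) (2 * a)) [2 * a * _]mulrC.
have := ltz_pmod (b + s) a20; have := modz_ge0 (b + s) (lt0r_neq0 a20).
by lia.
Qed.

(** The choice of [k] amounts to [b' <= s < b' + 2 * a] for the new middle coefficient [b'].
    Multiplied by [4 * a], each reducedness condition becomes a comparison of [D] with the square of
    [b'], [b' - 2 * a] or [b' + 2 * a]. *)
Lemma floor_flip_reduced s D f : int_sqrt_of s D -> reduced_form D f ->
  reduced_form D (floor_flip s f) /\ floor_flip s (floor_flip s f) = f.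
Proof.
move: f => [[a b] c] sD rf; have [b0 bs as1 as2] := reduced_form_bounds sD rf.
case: rf => a0 c0 acb cab DE; have := @floor_bounds s a b a0.
have a40 : 0 < 4 * a by lia.
rewrite /floor_flip; set k := ((b + s) %/ (2 * a))%Z => /= kP.
have k1 : 1 <= k by nia.
(* The flipped form has the same [k], since [0 <= s - b < 2 * a]; hence flipping twice is the
   identity. *)
have -> : ((2 * a * k - b + s) %/ (2 * a))%Z = k.
  rewrite -addrA [2 * a * k]mulrC divzMDl; last by lia.
  by rewrite divz_small ?addr0//; lia.
set b' := 2 * a * k - b; set c' := c + k * b - k ^+ 2 * a.
have DE' : b' ^+ 2 + 4 * a * c' = D by rewrite -DE /b' /c'; ring.
split; last by rewrite /b' /c'; congr (_, _, _); ring.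
have ak : a <= a * k by rewrite ler_peMr// ltW.
have bD : b' ^+ 2 < D by rewrite (sqr_lt_int_sqrt _ sD) /b'; lia.
have bmD : (b' - 2 * a) ^+ 2 < D by rewrite (sqr_lt_int_sqrt _ sD) /b'; lia.
have Dbp : D < (b' + 2 * a) ^+ 2 by rewrite (int_sqrt_lt_sqr _ sD) /b'; lia.
have cE : 4 * a * c' = D - b' ^+ 2 by rewrite -DE'; ring.
have mE : 4 * a * (b' - (a - c')) = D - (b' - 2 * a) ^+ 2 by rewrite -DE'; ring.
have pE : 4 * a * (b' - (c' - a)) = (b' + 2 * a) ^+ 2 - D by rewrite -DE'; ring.
split=> //; rewrite -?[_ < b']subr_gt0 -(pmulr_rgt0 _ a40).
- by rewrite cE subr_gt0.
- by rewrite mE subr_gt0.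
- by rewrite pE subr_gt0.
Qed.

(** * Irrationality of [sqrt D], and the correspondence between forms and reduced numbers *)

Definition nonsquare D := forall m n : int, m ^+ 2 * D = n ^+ 2 -> m = 0.

Lemma nonsquare_rat D (r : rat) : nonsquare D -> r ^+ 2 != D%:~R.
Proof.
move=> nsD; apply/eqP => rD; move/eqP: (denq_neq0 r); apply; apply: (nsD _ (numq r)).
apply/(intr_inj (R := rat)); rewrite rmorphM !rmorphXn /= -rD.
by rewrite -[in X in _ * X](divq_num_den r); field; rewrite intr_eq0 denq_neq0.
Qed.

Section RootOfForm.
Variables (R : realType) (D : nat).
Hypothesis nsD : nonsquare D.

Let sqrtD : R := Num.sqrt D%:R.

Definition root_of_form (f : form) : R :=
  let: (a, b, c) := f in (b%:~R + sqrtD) / (2 * a%:~R).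

Let sqr_sqrtD : sqrtD ^+ 2 = D%:R.
Proof. by rewrite sqr_sqrtr. Qed.

Lemma root_of_form_irrational f : 0 < f.1.1 -> irrational (root_of_form f).
Proof.
move: f => [[a b] c] /= a0 [q _ qE].
have aR : a%:~R != 0 :> R by rewrite intr_eq0 gt_eqF.
have := nonsquare_rat (2 * a%:~R * q - b%:~R) nsD; apply/negP; rewrite negbK.
apply/eqP/(fmorph_inj (ratr : {rmorphism rat -> R})).
rewrite rmorphXn rmorphB !rmorphM /= qE !ratr_int ratr_nat -[D%:~R]/(D%:R) -sqr_sqrtD.
by congr (_ ^+ 2); field.
Qed.

(** Equal roots give a linear relation over the integers between [sqrtD] and 1; irrationality forces
    equal [a], then equal [b], and the discriminant fixes [c]. *)
Lemma root_of_form_inj : {in reduced_form D &, injective root_of_form}.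
Proof.
move=> [[a b] c] [[a1 b1] c1] /set_mem[a0 _ _ _ DE] /set_mem[a10 _ _ _ DE1].
have aR : a%:~R != 0 :> R by rewrite intr_eq0 gt_eqF.
have a1R : a1%:~R != 0 :> R by rewrite intr_eq0 gt_eqF.
rewrite /= => fE.
have E : (a1 - a)%:~R * sqrtD = (a * b1 - a1 * b)%:~R.
  move: fE => /(congr1 (fun x => x * (2 * a%:~R * a1%:~R))).
  have -> : (b%:~R + sqrtD) / (2 * a%:~R) * (2 * a%:~R * a1%:~R) =
    (b%:~R + sqrtD) * a1%:~R by field.
  have -> : (b1%:~R + sqrtD) / (2 * a1%:~R) * (2 * a%:~R * a1%:~R) =
    (b1%:~R + sqrtD) * a%:~R by field.
  by rewrite !rmorphB !rmorphM /=; lra.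
have aa1 : a1 - a = 0.
  apply: (nsD (n := a * b1 - a1 * b)); apply/(intr_inj (R := R)).
  by rewrite rmorphM !rmorphXn /= -E exprMn sqr_sqrtD.
have {}aa1 : a1 = a by lia.
have bb1 : b1 = b.
  have : a * (b1 - b) = 0.
    by apply/(intr_inj (R := R)); rewrite mulrBr -{2}aa1 -E aa1 subrr mul0r.
  by nia.
by move: DE DE1; rewrite aa1 bb1 => DE DE1; congr (_, _, _); nia.
Qed.

Lemma root_of_form_reduced f : (reduced_form D `&` primitive_form) f ->
  reduced_of_disc D (root_of_form f).
Proof.
move=> [rf gf]; have wirr : irrational (root_of_form f).
  by apply: root_of_form_irrational; case: f rf {gf} => [[a b] c] [].
move: f rf gf wirr => [[a b] c] [a0 c0 acb cab DE] gf.
set w := root_of_form _ => wirr; pose v : R := (b%:~R - sqrtD) / (2 * a%:~R).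
have a0R : 0 < a%:~R :> R by rewrite ltr0z.
have aR : a%:~R != 0 :> R by rewrite lt0r_neq0.
have DER : D%:R = b%:~R ^+ 2 + 4 * a%:~R * c%:~R :> R.
  by rewrite -[D%:R]/((D%:Z)%:~R) -DE rmorphD rmorphXn !rmorphM /=.
have qw : quad_eval a (- b) (- c) w = 0.
  rewrite /quad_eval /w /= !rmorphN /=.
  (* Eliminating [c] builds the discriminant equation into the goal, which is then an identity in
     [b], [a] and [sqrtD]. *)
  have cR : c%:~R = (sqrtD ^+ 2 - b%:~R ^+ 2) / (4 * a%:~R) :> R.
    by rewrite sqr_sqrtD DER; field.
  by rewrite cR; field.
have b0 : 0 < b by lia.
have b0R : 0 < b%:~R :> R by rewrite ltr0z.
have c0R : 0 < c%:~R :> R by rewrite ltr0z.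
have s0 : 0 < sqrtD by rewrite sqrtr_gt0 DER; nra.
have lt_sqrtD x : 0 <= x -> (x < sqrtD) = (x ^+ 2 < D%:R).
  by move=> x0; rewrite -sqr_sqrtD ltr_pXn2r// nnegrE ltW.
have acR : a%:~R - c%:~R < b%:~R :> R by rewrite -rmorphB ltr_int.
have caR : c%:~R - a%:~R < b%:~R :> R by rewrite -rmorphB ltr_int.
have bs : b%:~R < sqrtD by rewrite lt_sqrtD ?ltW// DER; nra.
have sb : sqrtD < 2 * a%:~R + b%:~R.
  rewrite ltNge le_eqVlt lt_sqrtD ?DER; last by nra.
  by apply/negP => /orP[/eqP e|]; [move: sqr_sqrtD; rewrite -e DER|]; nra.
have ab : 2 * a%:~R - b%:~R < sqrtD.
  have [h|h] := ltP (2 * a%:~R - b%:~R) (0 : R); first exact: lt_trans s0.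
  by rewrite lt_sqrtD// DER; nra.
have a2 : 0 < 2 * a%:~R :> R by rewrite mulr_gt0.
split; last first.
  exists a, (- b), (- c); split=> //; last by rewrite -DE; ring.
  by move: gf; rewrite /primitive_form /= /gcdz !abszN.
split.
- by split=> //; exists a, (- b), (- c); split; rewrite ?lt0r_neq0.
- by rewrite /w /= ltr_pdivlMr//; lra.
exists v; split; last first.
  by rewrite /v ltr_pdivlMr// pmulr_llt0 ?invr_gt0//; apply/andP; split; lra.
split.
  apply/eqP => /(congr1 (fun x => x * (2 * a%:~R))).
  by rewrite /v /w /= !divfK ?gt_eqF//; lra.
have aQ : a%:~R != 0 :> rat by rewrite intr_eq0 gt_eqF.
(* The common minimal polynomial of [w] and [v]; having degree 2, it is irreducible once it has no
   rational root. *)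
pose m : {poly rat} := 'X^2 - (b%:~R / a%:~R) *: 'X - (c%:~R / a%:~R)%:P.
pose l : {poly rat} := - ((b%:~R / a%:~R) *: 'X) - (c%:~R / a%:~R)%:P.
have mE : m = 'X^2 + l by rewrite /m /l addrA.
have size_l : (size l < 3)%N.
  rewrite (leq_ltn_trans (size_polyD _ _))// gtn_max !size_polyN.
  rewrite (leq_ltn_trans (size_scale_leq _ _)) ?size_polyX//=.
  by rewrite (leq_ltn_trans (size_polyC_leq1 _)).
have size_m : size m = 3%N by rewrite mE size_polyDl size_polyXn.
have hornerm (S : fieldType) (h : {rmorphism rat -> S}) x :
    (map_poly h m).[x] = x ^+ 2 - (h b%:~R / h a%:~R) * x - h c%:~R / h a%:~R.
  by rewrite /m !rmorphB /= map_polyZ map_polyXn map_polyX map_polyC /=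
    !hornerE !fmorph_div.
exists m; split.
- by rewrite mE monicE lead_coefDl ?size_polyXn// lead_coefXn.
- apply: cubic_irreducible; first by rewrite size_m.
  move=> x; apply/negP => /rootP mx.
  have /eqP := nonsquare_rat (2 * a%:~R * x - b%:~R) nsD; apply.
  have := hornerm rat idfun x; rewrite map_poly_id// mx => /esym xE.
  have -> : D%:~R = b%:~R ^+ 2 + 4 * a%:~R * c%:~R :> rat.
    by rewrite -DE rmorphD rmorphXn !rmorphM /=.
  (* Completing the square: a rational root of [m] would yield a rational square root of [D]. *)
  have -> : (2 * a%:~R * x - b%:~R) ^+ 2 = b%:~R ^+ 2 + 4 * a%:~R * c%:~R +
    4 * a%:~R ^+ 2 * (x ^+ 2 - (b%:~R / a%:~R) * x - c%:~R / a%:~R) by field.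
  by rewrite xE mulr0 addr0.
- apply/rootP; rewrite hornerm /= !ratr_int.
  have -> : w ^+ 2 - b%:~R / a%:~R * w - c%:~R / a%:~R =
      quad_eval a (- b) (- c) w / a%:~R.
    by rewrite /quad_eval !rmorphN /=; field.
  by rewrite qw mul0r.
- apply/rootP; rewrite hornerm /= !ratr_int.
  have -> : c%:~R = (sqrtD ^+ 2 - b%:~R ^+ 2) / (4 * a%:~R) :> R.
    by rewrite sqr_sqrtD DER; field.
  by rewrite /v; field.
Qed.

Lemma reduced_of_disc_root w : reduced_of_disc D w ->
  exists2 f, (reduced_form D `&` primitive_form) f & root_of_form f = w.
Proof.
move=> [[_ w1 [v [wv /andP[v1 v0]]]] [a [b [c [a0 gf qw dD]]]]].
have qv := conjugate_root (lt0r_neq0 a0) wv qw.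
have a0R : 0 < a%:~R :> R by rewrite ltr0z.
have w_v : 0 < w - v by lra.
(* Vieta's formula: subtract the equations of [w] and [v] and cancel [w - v]. *)
have bE : b%:~R = - (a%:~R * (w + v)) :> R.
  apply: (mulIf (lt0r_neq0 w_v)).
  by move: qw qv; rewrite /quad_eval => qw qv; lra.
have cE : c%:~R = a%:~R * (w * v) :> R.
  by move: qw; rewrite /quad_eval bE => qw; lra.
exists (a, - b, - c).
  split; last by move: gf; rewrite /primitive_form /= /gcdz !abszN.
  split; rewrite ?dD//; last by ring.
  - by rewrite -(ltr_int R) rmorphN /= cE -mulrN pmulr_rgt0// oppr_gt0 pmulr_rlt0//; lra.
  - rewrite -(ltr_int R) rmorphB !rmorphN /= bE cE.
    have : 0 < a%:~R * ((w - 1) * (1 - v)) by rewrite !mulr_gt0//; lra.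
    by lra.
  - rewrite -(ltr_int R) rmorphB !rmorphN /= bE cE.
    have : 0 < a%:~R * ((w + 1) * (1 + v)) by rewrite !mulr_gt0//; lra.
    by lra.
rewrite /= /sqrtD; have -> : D%:R = (a%:~R * (w - v)) ^+ 2 :> R.
  by rewrite -[D%:R]/((D%:Z)%:~R) dD rmorphB expr2 !rmorphM /= bE cE; ring.
rewrite sqrtr_sqr ger0_norm; last by rewrite mulr_ge0// ltW.
by rewrite rmorphN /= bE; field; rewrite lt0r_neq0.
Qed.

Lemma kappaE : kappa R D = ncard (reduced_form D `&` primitive_form).
Proof.
rewrite -(ncard_inj (f := root_of_form)).
- congr ncard; apply/seteqP; split=> [w /reduced_of_disc_root[f rf <-]|_ [f rf <-]].
  + by exists f.
  + exact: root_of_form_reduced.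
- by apply: sub_finite_set (finite_reduced_form D) => f [].
- move=> f g /set_mem[rf _] /set_mem[rg _]; apply: root_of_form_inj; exact: mem_set.
Qed.

End RootOfForm.

(** * Discriminants [p] and [4 p]: nonsquareness and primitivity *)

Lemma nonsquare_prime (p : nat) : prime p -> nonsquare p.
Proof.
move=> p_prime m n mnE; apply/eqP; case: eqP => // /eqP m0.
have E : (`|m| ^ 2 * p = `|n| ^ 2)%N by lia.
have p0 := prime_gt0 p_prime.
(* The exponent of [p] is odd on the left and even on the right. *)
have := congr1 (logn p) E; rewrite lognM ?expn_gt0 ?absz_gt0 ?m0//.
by rewrite !lognX (logn_prime p p_prime) eqxx => /(congr1 odd); rewrite oddD !oddM.
Qed.

Lemma nonsquare_prime4 (p : nat) : prime p -> nonsquare (4 * p)%N.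
Proof.
move=> p_prime m n mnE; have := @nonsquare_prime p p_prime (2 * m) n.
have -> : (2 * m) ^+ 2 * p = n ^+ 2 by rewrite -mnE PoszM; ring.
by move=> /(_ erefl); lia.
Qed.

Lemma sqr_mul_prime (p : nat) (g x : int) :
  prime p -> 0 <= g -> g ^+ 2 * x = p -> g = 1.
Proof.
move=> p_prime g0 gE; have E : (`|g| ^ 2 * `|x| = p)%N by lia.
have gp : (`|g| %| p)%N by rewrite -E expnS -mulnA dvdn_mulr.
case/primeP: (p_prime) => p_gt1 /(_ _ gp) /orP[|] /eqP gE'; first by lia.
(* If [g = p], cancelling one factor leaves [p * |x| = 1]. *)
move/eqP: E; rewrite gE' expnS expn1 -mulnA -[X in _ == X]muln1.
by rewrite eqn_pmul2l ?prime_gt0// muln_eq1; lia.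
Qed.

Lemma gcd3_dvd a b c : let g := gcdz (gcdz a b) c in
  [/\ (g %| a)%Z, (g %| b)%Z & (g %| c)%Z].
Proof.
move=> g; split; last exact: dvdz_gcdr.
- exact: dvdz_trans (dvdz_gcdl _ _) (dvdz_gcdl _ _).
- exact: dvdz_trans (dvdz_gcdl _ _) (dvdz_gcdr _ _).
Qed.

(** The square of the gcd of the coefficients divides the discriminant. *)
Lemma primitive_prime_disc (p : nat) : prime p ->
  reduced_form p `&` primitive_form = reduced_form p.
Proof.
move=> p_prime; apply/seteqP; split=> [f []//|[[a b] c] rf]; split=> //.
case: rf => _ _ _ _; rewrite /primitive_form /=.
have [] := gcd3_dvd a b c; set g := gcdz _ c.
move=> /dvdzP[a' ->] /dvdzP[b' ->] /dvdzP[c' ->] E.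
apply: (@sqr_mul_prime p g (b' ^+ 2 + 4 * a' * c')) => //.
by rewrite -E; ring.
Qed.

(** * Splitting forms by the parities of [a] and [c]; [true] stands for odd *)

Definition parity_class D (i j : bool) : set form := [set f |
  reduced_form D f /\ ((2 %| f.1.1)%Z, (2 %| f.2)%Z) = (~~ i, ~~ j)].

(** If [a] and [c] are even, so is [b]. Otherwise the gcd [g] is odd, so the factor 4 can be
    cancelled and [g ^+ 2] divides [p]. *)
Lemma primitive_4prime_disc (p : nat) f : prime p ->
  (reduced_form (4 * p)%N `&` primitive_form) f <->
  reduced_form (4 * p)%N f /\ ~ parity_class (4 * p)%N false false f.
Proof.
move: f => [[a b] c] p_prime; split=> -[rf gf]; split=> //.
  move=> [_ [a2 c2]]; case: rf => _ _ _ _ E.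
  have b2 : (2 %| b)%Z by nia.
  move: gf; rewrite /primitive_form /= => gE.
  by have : (2 %| gcdz (gcdz a b) c)%Z; [rewrite !dvdz_gcd a2 b2 c2 | rewrite gE].
have {}gf : ~~ ((2 %| a)%Z && (2 %| c)%Z).
  by apply/negP => /andP[a2 c2]; apply: gf; split=> //=; rewrite a2 c2.
case: rf => _ _ _ _; rewrite /primitive_form /=.
have [] := gcd3_dvd a b c; set g := gcdz _ c => ga gb gc.
have g2 : ~~ (2 %| g)%Z.
  by apply: contra gf => g2; rewrite !(dvdz_trans g2).
case/dvdzP: ga => a' ->; case/dvdzP: gb => b' ->; case/dvdzP: gc => c' -> E.
have {}E : g ^+ 2 * (b' ^+ 2 + 4 * a' * c') = 4 * p%:Z by rewrite -PoszM -E; ring.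
have : (4 %| g ^+ 2 * (b' ^+ 2 + 4 * a' * c'))%Z by rewrite E dvdz_mulr.
rewrite Gauss_dvdzr => [/dvdzP[y yE]|].
  apply: (@sqr_mul_prime p g y) => //.
  by move: E; rewrite yE mulrA [_ * 4]mulrC; apply: mulfI.
by rewrite (_ : 4%:R = 2 ^+ 2 :> int)// coprimezXl// coprimezXr//
  coprimezE coprime2n; lia.
Qed.

Lemma parity_class_swap D i j :
  ncard (parity_class D i j) = ncard (parity_class D j i).
Proof.
pose sw (f : form) : form := (f.2, f.1.2, f.1.1).
have fin : finite_set (parity_class D i j).
  by apply: sub_finite_set (finite_reduced_form D) => f [].
apply: (ncard_cancel (f := sw) (g := sw)) => // -[[a b] c];
  rewrite /parity_class /reduced_form /sw /= => -[[? ? ? ? E] [-> ->]];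
  by split=> //; split=> //; split=> //; rewrite -E; ring.
Qed.

Lemma finite_parity_class D i j : finite_set (parity_class D i j).
Proof. by apply: sub_finite_set (finite_reduced_form D) => f []. Qed.

Lemma int_sqrt_exists (D : nat) : nonsquare D -> exists s, int_sqrt_of s D.
Proof.
move=> nsD; suff [s /andP[sD Ds]] : exists s : nat, (s ^ 2 <= D < s.+1 ^ 2)%N.
  exists s%:Z; split=> //; rewrite lt_neqAle; apply/andP; split; last by lia.
  apply/andP; split; last by lia.
  by apply/eqP => sDE; have := nsD 1 s; rewrite sDE expr1n mul1r => /(_ erefl).
elim: D {nsD} => [|D [s /andP[sD Ds]]]; first by exists 0%N.
case: (leqP (s.+1 ^ 2) D.+1) => sD'; last by exists s; lia.
by exists s.+1; nia.
Qed.

Lemma ncard_unequal_parities D :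
  ncard [set f | reduced_form D f /\ (2 %| f.1.1)%Z != (2 %| f.2)%Z] =
  (2 * ncard (parity_class D true false))%N.
Proof.
rewrite mul2n -addnn {1}parity_class_swap; apply: ncard_split.
- by apply: sub_finite_set (finite_reduced_form D) => f [].
- move=> f; rewrite /parity_class /=.
  case: (2 %| f.1.1)%Z; case: (2 %| f.2)%Z => /=;
    split=> [[? ?]|[[? ?]|[? ?]]] //; try by [left|right|split].
- by move=> f [_ [e _]] [_ []]; rewrite e.
Qed.

Lemma ncard_reduced_form_parities D : ncard (reduced_form D) =
  (ncard [set f | reduced_form D f /\ (2 %| f.1.1)%Z = (2 %| f.2)%Z] +
   2 * ncard (parity_class D true false))%N.
Proof.
rewrite -ncard_unequal_parities; apply: ncard_split.
- exact: finite_reduced_form.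
- move=> f /=; case: eqVneq => h; split=> [?|[[]|[]]] //.
  + by left.
  + by right.
- by move=> f [_ e] [_]; rewrite e eqxx.
Qed.

Lemma ncard_primitive_4prime_disc (p : nat) : prime p ->
  ncard (reduced_form (4 * p)%N `&` primitive_form) =
  (ncard (parity_class (4 * p)%N true true) +
   2 * ncard (parity_class (4 * p)%N true false))%N.
Proof.
move=> p_prime; rewrite -ncard_unequal_parities; apply: ncard_split.
- by apply: sub_finite_set (finite_reduced_form (4 * p)%N) => f [].
- move=> f; rewrite primitive_4prime_disc// /parity_class /=.
  case: (2 %| f.1.1)%Z; case: (2 %| f.2)%Z => /=;
    split=> [[? h]|[[? h]|[? h]]] //;
      by [left | right | case: h; split | split=> // -[_]].
- by move=> f [_ [e e']] [_]; rewrite e e' eqxx.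
Qed.

(** * Congruences modulo 4 and 8, and the sizes of the parity classes *)

Lemma even_half a : (2 %| a)%Z -> exists x, a = 2 * x.
Proof. by exists (a %/ 2)%Z; lia. Qed.

Lemma odd_half a : ~~ (2 %| a)%Z -> exists x, a = 2 * x + 1.
Proof. by exists (a %/ 2)%Z; lia. Qed.

Lemma even_sqr a : (2 %| a ^+ 2)%Z -> (2 %| a)%Z.
Proof. by move=> a2; apply/negPn/negP => /odd_half[x aE]; rewrite aE in a2; lia. Qed.

(* In terms of [B = b / 2], [s = (a + c) / 2] and [d = (a - c) / 2] the equation
   [B ^ 2 + a * c = p] reads [B ^ 2 + s ^ 2 - d ^ 2 = p]: exchange [B] and [s]. *)
Lemma ncard_equal_parities (p : nat) : p = 1 %[mod 4] ->
  ncard [set f | reduced_form p f /\ (2 %| f.1.1)%Z = (2 %| f.2)%Z] =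
  ncard (parity_class (4 * p)%N true true).
Proof.
move=> p4.
pose to (f : form) : form := let: (a, b, c) := f in
  (b + a - c, 2 * (a + c), b - a + c).
pose from (f : form) : form := let: (a, b, c) := f in
  (((b + a - c) %/ 4)%Z, ((a + c) %/ 2)%Z, ((b - a + c) %/ 4)%Z).
apply: (ncard_cancel (f := to) (g := from)) => [|[[a b] c]|[[a b] c]].
- by apply: sub_finite_set (finite_reduced_form p) => f [].
- rewrite /to /from /= => -[[a0 c0 acb cab E] ac].
  have b2 : ~~ (2 %| b)%Z by apply/negP => /even_half[x bE]; rewrite bE in E; lia.
  split; last by congr (_, _, _); lia.
  split; last by congr (_, _) => /=; lia.
  by split; [lia|lia|lia|lia|rewrite PoszM -E; ring].
- move=> [[a0 c0 acb cab E] [a2 c2]]; rewrite /= in a2 c2.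
  have [u aE] := odd_half (negbT a2); have [v cE] := odd_half (negbT c2).
  have b2 : (2 %| b)%Z by apply: even_sqr; lia.
  have [B bE] := even_half b2.
  have {}E : B ^+ 2 + a * c = p by lia.
  have B2 : (2 %| B)%Z by apply: even_sqr; rewrite aE cE in E; lia.
  have [C BE] := even_half B2.
  (* As [B] is even, [a * c] is 1 modulo 4, so [a] and [c] agree modulo 4. This makes the divisions
     in [from] exact and gives the outer coefficients of its value equal parity. *)
  have ac4 : (4 %| a - c)%Z.
    have : 4 * (C ^+ 2 + u * v) + 2 * (u + v) + 1 = p by rewrite -E BE aE cE; ring.
    by lia.
  have [x xE] : exists x, b + a - c = 4 * x by exists ((b + a - c) %/ 4)%Z; lia.
  have [y yE] : exists y, b - a + c = 4 * y by exists ((b - a + c) %/ 4)%Z; lia.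
  have [z zE] : exists z, a + c = 2 * z by exists ((a + c) %/ 2)%Z; lia.
  have -> : from (a, b, c) = (x, z, y) by rewrite /from; congr (_, _, _); lia.
  split; last by rewrite /to; congr (_, _, _); lia.
  split; last by rewrite /=; lia.
  split; [lia|lia|lia|lia|].
  have -> : z = a - (x - y) by lia.
  have BE' : B = x + y by lia.
  by rewrite -E BE' (_ : c = a - 2 * (x - y)); [ring | lia].
Qed.

(** With [a] even, [c] odd and [b = 2 * B], the equation [B ^+ 2 + a * c = p] makes [B] odd and 4 a
    divisor of [a]. A fixed point of the flip has [b = a * k], which would make [B] even. *)
Lemma even_ncard_4prime (p : nat) : prime p -> p = 1 %[mod 4] ->
  ~~ odd (ncard (parity_class (4 * p)%N true false)).
Proof.
move=> p_prime p4; have [s sD] := int_sqrt_exists (nonsquare_prime4 p_prime).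
rewrite parity_class_swap.
have halfb a b c : parity_class (4 * p)%N false true (a, b, c) ->
    exists B e, [/\ b = 2 * B, a = 4 * e & (B %% 2)%Z = 1].
  move=> [[_ _ _ _ E] [a2 c2]]; rewrite /= in a2 c2.
  have [e aE] := even_half a2; have [y cE] := odd_half (negbT c2).
  have b2 : (2 %| b)%Z by apply: even_sqr; lia.
  have [B bE] := even_half b2.
  have {}E : B ^+ 2 + 2 * (e * c) = p.
    by apply: (mulfI (_ : 4 != 0)) => //; rewrite -PoszM -E bE aE; ring.
  have B2 : ~~ (2 %| B)%Z by apply/negP => /even_half[C BE]; rewrite BE in E; lia.
  have [C BE] := odd_half B2.
  have e2 : (2 %| e)%Z.
    have : 4 * (C ^+ 2 + C + e * y) + 1 + 2 * e = p by rewrite -E BE cE; ring.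
    by lia.
  have [x eE] := even_half e2.
  by exists B, x; split=> //; rewrite ?aE ?eE; lia.
rewrite (@odd_ncard_involution _ (floor_flip s) _ set0).
- by rewrite /ncard fset_set0 cardfs0.
- exact: finite_parity_class.
- move=> [[a b] c] cf; have [B [e [bE aE B2]]] := halfb _ _ _ cf.
  case: cf => rf [a2 c2]; have [rf' ff] := floor_flip_reduced sD rf.
  split=> //; split=> //; rewrite /floor_flip; set k := (_ %/ _)%Z => /=.
  have -> : c + k * b - k ^+ 2 * a = c + 2 * (k * B - 2 * (k ^+ 2 * e)).
    by rewrite bE aE; ring.
  by rewrite /= in a2 c2; congr (_, _); lia.
- move=> [[a b] c]; split=> // -[cf]; have [B [e [bE aE B2]]] := halfb _ _ _ cf.
  rewrite /floor_flip; set k := (_ %/ _)%Z => -[bk _].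
  have : B = 2 * (e * k) by rewrite bE aE in bk; lia.
  by lia.
Qed.

Lemma odd_sqr_mod8 (x : int) : exists t, (2 * x + 1) ^+ 2 = 8 * t + 1.
Proof.
have /even_half[t tE] : (2 %| x * (x + 1))%Z by rewrite dvdzE abszM Euclid_dvdM//; lia.
exists t; have -> : (2 * x + 1) ^+ 2 = 4 * (x * (x + 1)) + 1 by ring.
by rewrite tE; lia.
Qed.

(** Here [b] is odd, so [b ^+ 2] is 1 modulo 8 and [p] is [1 + 4 * c] modulo 8. *)
Lemma even_coef_mod8 a b c (p : nat) : b ^+ 2 + 4 * a * c = p -> ~~ (2 %| a)%Z ->
  p = 1 %[mod 4] -> (2 %| c)%Z = (p %% 8 == 1)%N.
Proof.
move=> E /odd_half[u aE] p4.
have b2 : ~~ (2 %| b)%Z by apply/negP => /even_half[x bE]; rewrite bE aE in E; lia.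
have [m bE] := odd_half b2; have [t tE] := odd_sqr_mod8 m.
have {}E : 8 * (t + u * c) + 4 * c + 1 = p by rewrite -E bE tE aE; ring.
by lia.
Qed.

(* The flip is fixed only where [a] divides [b], hence [a] divides [p]; this
   leaves [a = 1], with [b] the largest odd integer below [sqrt p]. *)
Lemma odd_ncard_prime (p : nat) : prime p -> p = 1 %[mod 8] ->
  odd (ncard (parity_class p true false)).
Proof.
move=> p_prime p8; have [s sD] := int_sqrt_exists (nonsquare_prime p_prime).
have p4 : p = 1 %[mod 4] by lia.
have p1 := prime_gt1 p_prime.
have s2 : 2 < s.
  rewrite ltNge; apply/negP => s2; case: (sD) => s0 /andP[_].
  have : (s + 1) ^+ 2 <= 3 ^+ 2 by rewrite lerXn2r ?nnegrE//; lia.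
  by lia.
have [n nE] : exists n, s = 2 * n + 1 \/ s = 2 * n + 2.
  by exists ((s - 1) %/ 2)%Z; lia.
set b0 : int := 2 * n + 1; have [t tE] := odd_sqr_mod8 n; rewrite -/b0 in tE.
(* Chosen so that [b0 ^+ 2 + 8 * c0 = p]: both [p] and [b0 ^+ 2] are 1 modulo 8. *)
pose c0 : int := (p %/ 8)%N%:Z - t.
have E0 : b0 ^+ 2 + 4 * 1 * (2 * c0) = p by rewrite tE /c0; lia.
have b0p : b0 ^+ 2 < p by rewrite (sqr_lt_int_sqrt _ sD) /b0; lia.
have pb0 : p%:Z < (b0 + 2) ^+ 2 by rewrite (int_sqrt_lt_sqr _ sD) /b0; lia.
rewrite (@odd_ncard_involution _ (floor_flip s) _ [set (1, b0, 2 * c0) : form]).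
- by rewrite /ncard fset_set1 cardfs1.
- exact: finite_parity_class.
- move=> [[a b] c] [rf [a2 c2]]; have [rf' ff] := floor_flip_reduced sD rf.
  split=> //; split=> //=; rewrite /= in a2 c2; congr (_, _) => //.
  (* The flip keeps [a] and the discriminant, and these determine the parity of [c]. *)
  by case: rf' => _ _ _ _ /even_coef_mod8 ->; rewrite ?a2//; lia.
move=> [[a b] c]; split=> [[-> -> ->]|[[rf [a2 c2]]]].
  split; last first.
    have kE : ((b0 + s) %/ (2 * 1))%Z = b0 by rewrite /b0; lia.
    by rewrite /floor_flip kE; congr (_, _, _); ring.
  split; last by rewrite /=; congr (_, _); lia.
  (* This is the condition [c - a < b] for the form [(1, b0, 2 * c0)], multiplied by 4. *)
  have {}pb0 : 8 * c0 < 4 * b0 + 4.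
    have : (b0 + 2) ^+ 2 = b0 ^+ 2 + 4 * b0 + 4 by ring.
    by lia.
  by split=> //; clear -E0 b0p pb0 nE s2; rewrite /b0 in pb0 *; lia.
case: rf => a0 c0' acb cab E; have := floor_bounds s b a0.
rewrite /floor_flip; set k := (_ %/ _)%Z => kP [bk _].
have {bk} bE : b = a * k by clear -bk; lia.
have aE : a = 1.
  have pE : a * (a * k ^+ 2 + 4 * c) = p by rewrite -E bE; ring.
  have ap : (`|a| %| p)%N by rewrite -[p]/`|p%:Z|%N -pE abszM dvdn_mulr.
  case/primeP: (p_prime) => _ /(_ _ ap) /orP[|] /eqP aE; first by clear -aE a0; lia.
  have {}aE : a = p by clear -aE a0; lia.
  (* The case [a = p] leaves cofactor 1, impossible because [c > 0]. *)
  have E1 : a * k ^+ 2 + 4 * c = 1.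
    by apply: (mulfI (lt0r_neq0 a0)); rewrite pE mulr1 aE.
  have : 0 <= a * k ^+ 2 by rewrite mulr_ge0 ?sqr_ge0// ltW.
  by clear -E1 c0'; lia.
have b2 : ~~ (2 %| b)%Z.
  by apply/negP => /even_half[x xE]; rewrite xE in E; clear -E p4; lia.
(* With [a = 1] and [k = b], the floor bounds read [b <= s < b + 2], which has one odd solution. *)
have bb0 : b = b0.
  by rewrite /b0; rewrite aE in kP bE; clear -kP bE b2 nE; lia.
by rewrite aE bb0 in E *; congr (_, _, _); clear -E E0; lia.
Qed.

Lemma ncard_prime_5mod8 (p : nat) : p = 5 %[mod 8] ->
  ncard (parity_class p true false) = 0%N.
Proof.
move=> p8; suff -> : parity_class p true false = set0.
  by rewrite /ncard fset_set0 cardfs0.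
apply/seteqP; split=> // -[[a b] c] [[_ _ _ _ E] [a2 c2]].
by have := even_coef_mod8 E (negbT a2); rewrite c2; lia.
Qed.

End CaliberParity.

Theorem theorem3p4 (R : realType) (p : nat) (p_prime : prime p)
    (p_mod4 : p = 1 %[mod 4]) :
  (p = 1 %[mod 8] -> kappa R p = kappa R (4 * p) + 2 %[mod 4]) /\
  (p = 5 %[mod 8] -> kappa R p = kappa R (4 * p) %[mod 4]).
Proof.
rewrite (kappaE R (nonsquare_prime p_prime)) primitive_prime_disc//.
rewrite (kappaE R (nonsquare_prime4 p_prime)) ncard_primitive_4prime_disc//.
rewrite ncard_reduced_form_parities ncard_equal_parities//.
have y_even := even_ncard_4prime p_prime p_mod4.
split=> [p8|p5]; first by have x_odd := odd_ncard_prime p_prime p8; lia.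
by rewrite ncard_prime_5mod8//; lia.
Qed.
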